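(* Let $a_k(x)=\sum_{m=0}^k\binom{2k+2-m}{k-m}x^m$ for $k\ge 0$, and let $H_n(x)=\det[a_{i+j}(x)]_{0\le i,j\le n}$ for $n\ge 0$. Then $$\sum_{n=0}^{\infty}H_n(x)t^n=\frac{1-t+t^2-t^3-xt-3xt^2}{(1+xt+t^2)^2}.$$
   Context: The identity is one of formal power series in $t$ with coefficients polynomials in $x$. $H_n(x)$ is the determinant of the $(n+1)\times(n+1)$ Hankel matrix with $(i,j)$ entry $a_{i+j}(x)$. *)

(* Defs.v *)
From HB Require Import structures.
From mathcomp Require Import all_boot all_order all_algebra.
From mathcomp Require Import boolp.

Set Implicit Arguments.
Unset Strict Implicit.
Unset Printing Implicit Defensive.

Import GRing.Theory.
Local Open Scope ring_scope.

(* Formal power series in one indeterminate over R: [Fps f] is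
   \sum_(n >= 0) f n * t ^+ n, with the Cauchy product as multiplication. *)
Record fps (R : Type) := Fps { fps_coef : nat -> R }.

Lemma fpsP (R : Type) (f g : fps R) :
  (forall n, fps_coef f n = fps_coef g n) <-> f = g.
Proof.
split=> [|-> //]; case: f g => [f] [g] /= fg.
by congr Fps; apply/funext.
Qed.

HB.instance Definition _ (R : Type) := gen_eqMixin (fps R).
HB.instance Definition _ (R : Type) := gen_choiceMixin (fps R).

Section Zmodule.
Variable R : zmodType.
Implicit Types f g h : fps R.

Definition fps_zero : fps R := Fps (fun=> 0).
Definition fps_opp f : fps R := Fps (fun n => - fps_coef f n).
Definition fps_add f g : fps R := Fps (fun n => fps_coef f n + fps_coef g n).

Fact fps_addA : associative fps_add.
Proof. by move=> f g h; apply/fpsP => n /=; rewrite addrA. Qed.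
Fact fps_addC : commutative fps_add.
Proof. by move=> f g; apply/fpsP => n /=; rewrite addrC. Qed.
Fact fps_add0 : left_id fps_zero fps_add.
Proof. by move=> f; apply/fpsP => n /=; rewrite add0r. Qed.
Fact fps_addN : left_inverse fps_zero fps_opp fps_add.
Proof. by move=> f; apply/fpsP => n /=; rewrite addNr. Qed.

HB.instance Definition _ :=
  GRing.isZmodule.Build (fps R) fps_addA fps_addC fps_add0 fps_addN.

Lemma fps_coef0 n : fps_coef (0 : fps R) n = 0.
Proof. by []. Qed.
Lemma fps_coefD f g n : fps_coef (f + g) n = fps_coef f n + fps_coef g n.
Proof. by []. Qed.
Lemma fps_coefN f n : fps_coef (- f) n = - fps_coef f n.
Proof. by []. Qed.

End Zmodule.

Section ComRing.
Variable R : comNzRingType.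
Implicit Types f g h : fps R.

Definition fpsC (c : R) : fps R := Fps (fun n => if n == 0%N then c else 0).
Definition fpsX : fps R := Fps (fun n => (n == 1%N)%:R).

Definition fps_mul f g : fps R :=
  Fps (fun n => \sum_(i < n.+1) fps_coef f i * fps_coef g (n - i)).

Definition fps_trunc n f : {poly R} := \poly_(i < n) fps_coef f i.

Lemma fps_mulE f g m n : (n < m)%N ->
  fps_coef (fps_mul f g) n = (fps_trunc m f * fps_trunc m g)`_n.
Proof.
move=> nm; rewrite coefM /=; apply: eq_bigr => i _; rewrite !coef_poly.
by rewrite (leq_ltn_trans (leq_subr _ _) nm) (leq_ltn_trans _ nm) // -ltnS.
Qed.

Fact fps_mulC : commutative fps_mul.
Proof. by move=> f g; apply/fpsP => n; rewrite !(@fps_mulE _ _ n.+1) // mulrC. Qed.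

Fact fps_mulA : associative fps_mul.
Proof.
move=> f g h; apply/fpsP => n.
have truncM u v w : \sum_(i < n.+1) fps_coef u i * fps_coef (fps_mul v w) (n - i)
    = (fps_trunc n.+1 u * (fps_trunc n.+1 v * fps_trunc n.+1 w))`_n.
  rewrite coefM; apply: eq_bigr => i _.
  by rewrite coef_poly ltn_ord (@fps_mulE _ _ n.+1) // ltnS leq_subr.
rewrite [RHS](congr1 (fun u => fps_coef u n) (fps_mulC _ _)) /=.
by rewrite !truncM mulrA mulrC.
Qed.

Fact fps_mul1 : left_id (fpsC 1) fps_mul.
Proof.
move=> f; apply/fpsP => n /=; rewrite big_ord_recl /= mul1r subn0.
by rewrite big1 ?addr0 // => i _; rewrite mul0r.
Qed.

Fact fps_mulD : left_distributive fps_mul +%R.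
Proof.
move=> f g h; apply/fpsP => n /=; rewrite -big_split.
by apply: eq_bigr => i _; rewrite /= mulrDl.
Qed.

Fact fps_1neq0 : fpsC 1 != 0.
Proof.
by apply/eqP => /fpsP /(_ 0%N) /= /eqP; rewrite oner_eq0.
Qed.

HB.instance Definition _ := GRing.Zmodule_isComNzRing.Build (fps R)
  fps_mulA fps_mulC fps_mul1 fps_mulD fps_1neq0.

Lemma fps_coefM f g n :
  fps_coef (f * g) n = \sum_(i < n.+1) fps_coef f i * fps_coef g (n - i).
Proof. by []. Qed.
Lemma fps_coefC c n : fps_coef (fpsC c) n = if n == 0%N then c else 0.
Proof. by []. Qed.

Fact fpsC_is_zmod_morphism : zmod_morphism fpsC.
Proof. by move=> a b; apply/fpsP => -[|n] //=; rewrite subr0. Qed.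
Fact fpsC_is_monoid_morphism : monoid_morphism fpsC.
Proof.
split=> // a b; apply/fpsP => -[|n] /=; first by rewrite big_ord1.
by rewrite big_ord_recl /= mulr0 big1 ?addr0 // => i _; rewrite mul0r.
Qed.
HB.instance Definition _ :=
  GRing.isZmodMorphism.Build R (fps R) fpsC fpsC_is_zmod_morphism.
HB.instance Definition _ :=
  GRing.isMonoidMorphism.Build R (fps R) fpsC fpsC_is_monoid_morphism.

Lemma fps_coef1 n : fps_coef (1 : fps R) n = (n == 0%N)%:R.
Proof. by case: n. Qed.

Lemma fps_coefXM f n :
  fps_coef (fpsX * f) n = if n is m.+1 then fps_coef f m else 0.
Proof.
case: n => [|n]; rewrite fps_coefM; first by rewrite big_ord1 mul0r.
rewrite !big_ord_recl /= mul0r add0r mul1r subSS subn0.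
by rewrite big1 ?addr0 // => i _; rewrite mul0r.
Qed.

Lemma fps_coefXn m n : fps_coef (fpsX ^+ m) n = (n == m)%:R.
Proof.
elim: m n => [|m IHm] n; first by rewrite expr0 fps_coef1.
by rewrite exprS fps_coefXM; case: n.
Qed.

End ComRing.

(* A power series is a unit iff its constant coefficient is, which makes
   [f / g] the usual quotient when [fps_coef g 0] is a unit (and, following
   the convention of unitRingType, [f * g] otherwise). *)
Section ComUnitRing.
Variable R : comUnitRingType.
Implicit Types f g : fps R.

Definition fps_unit : pred (fps R) := fun f => fps_coef f 0%N \is a GRing.unit.

Fixpoint fps_inv_seq f n : seq R :=
  if n is m.+1 then
    let s := fps_inv_seq f m in
    rcons s ((fps_coef f 0%N)^-1 *
             ((m == 0%N)%:R - \sum_(i < m) fps_coef f (m - i) * s`_i))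
  else [::].

Definition fps_inv f : fps R :=
  if fps_unit f then Fps (fun n => (fps_inv_seq f n.+1)`_n) else f.

Lemma size_fps_inv_seq f n : size (fps_inv_seq f n) = n.
Proof. by elim: n => //= n IHn; rewrite size_rcons IHn. Qed.

Lemma nth_fps_inv_seq f n i : (i < n)%N ->
  (fps_inv_seq f n)`_i = (fps_inv_seq f i.+1)`_i.
Proof.
elim: n => // n IHn; rewrite ltnS leq_eqVlt => /predU1P[-> //|lt_in].
by rewrite [LHS]/= nth_rcons size_fps_inv_seq lt_in IHn.
Qed.

Fact fps_mulV : {in fps_unit, left_inverse 1 fps_inv *%R}.
Proof.
move=> f Uf; have Uf0 : fps_coef f 0%N \is a GRing.unit by [].
have -> : fps_inv f = Fps (fun n => (fps_inv_seq f n.+1)`_n).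
  by rewrite /fps_inv -[fps_unit f]/(f \in fps_unit) Uf.
apply/fpsP => n; rewrite fps_coefM fps_coef1 big_ord_recr.
have -> : fps_coef (Fps (fun n => (fps_inv_seq f n.+1)`_n)) n =
    (fps_coef f 0%N)^-1 * ((n == 0%N)%:R -
      \sum_(i < n) fps_coef f (n - i) * (fps_inv_seq f n)`_i).
  by rewrite [LHS]/= nth_rcons size_fps_inv_seq ltnn eqxx.
rewrite [ord_max : nat]/= subnn mulrAC mulVr // mul1r.
rewrite /= addrC -[RHS](subrK (\sum_(i < n) fps_coef f (n - i) *
  (fps_inv_seq f n)`_i)); congr (_ + _); apply: eq_bigr => i _.
by rewrite [LHS]mulrC (nth_fps_inv_seq _ (ltn_ord i)).
Qed.

Fact fps_unitPl f g : g * f = 1 -> fps_unit f.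
Proof.
move=> /fpsP /(_ 0%N); rewrite fps_coefM big_ord1 fps_coef1 => gf1.
by apply/unitrPr; exists (fps_coef g 0%N); rewrite mulrC.
Qed.

Fact fps_inv_out : {in [predC fps_unit], fps_inv =1 id}.
Proof. by move=> f /negPf nUf; rewrite /fps_inv -[fps_unit f]/(f \in fps_unit) nUf. Qed.

HB.instance Definition _ := GRing.ComNzRing_hasMulInverse.Build (fps R)
  fps_mulV fps_unitPl fps_inv_out.

Lemma fps_unitE f : (f \is a GRing.unit) = (fps_coef f 0%N \is a GRing.unit).
Proof. by []. Qed.

End ComUnitRing.

Definition hankel_entry (k : nat) : {poly int} :=
  \sum_(0 <= m < k.+1) 'C(2 * k + 2 - m, k - m)%:R *: 'X^m.

Definition hankel_det (n : nat) : {poly int} :=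
  \det (\matrix_(i < n.+1, j < n.+1) hankel_entry (i + j)).

(* Main.v *)
(** Put [Y = (1 + u)^2 / u] and let [L] be the linear functional with moments
    [L(1) = 0] and [L(Y^(k+1)) = a_k].  With [V_n] the Chebyshev polynomials
    [V_n = (u^n - u^-n) / (u - u^-1)], [L(V_n)] is the coefficient of [u^n] in
    [u^2 / ((1 - u)(1 + u - x u))].  By Bernstein-Szego,
    [F_n = V_(n+2) - x V_(n+1) + (x - 1) V_n] is almost orthogonal, and the sums
    [K_n = 1 - \sum_(i < n) W_i F_i], with [W_i] the Chebyshev value at [x],
    satisfy [L(K_n V_(j+1)) = W_n [j = n]] for [j <= n].  The combination
    [K_n(0) F_n - F_n(0) K_n] vanishes at [Y = 0], hence is [Y] times a
    (non-normalized) orthogonal polynomial for the moments [a_k].  Cramer's rule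
    yields [H_(n+1) / H_n = K_(n+2)(0) / K_(n+1)(0)], so [H_n = K_(n+1)(0)], and
    the series follows from
    [K_n(0) - K_(n+1)(0) = (-1)^(n+1) ((2n + 1) x + 2) W_n]. *)
Require Import Defs.
From HB Require Import structures.
From mathcomp Require Import all_boot all_order all_algebra.
From mathcomp Require Import ring zify.
Import GRing.Theory.
Local Open Scope ring_scope.
Set Implicit Arguments. Unset Strict Implicit. Unset Printing Implicit Defensive.

(* [cheb y n] is [U_(n-1)(y / 2)] for [U] of the second kind. *)
Fixpoint cheb (A : pzRingType) (y : A) n : A :=
  if n is m.+1 then if m is k.+1 then y * cheb y m - cheb y k else 1 else 0.

Arguments cheb : simpl never.

Lemma cheb0 (A : pzRingType) (y : A) : cheb y 0%N = 0. Proof. by []. Qed.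
Lemma cheb1 (A : pzRingType) (y : A) : cheb y 1%N = 1. Proof. by []. Qed.
Lemma chebSS (A : pzRingType) (y : A) n :
  cheb y n.+2 = y * cheb y n.+1 - cheb y n.
Proof. by []. Qed.

Lemma rmorph_cheb (A B : pzRingType) (f : {rmorphism A -> B}) y n :
  f (cheb y n) = cheb (f y) n.
Proof.
suff [] : f (cheb y n) = cheb (f y) n /\ f (cheb y n.+1) = cheb (f y) n.+1 by [].
elim: n => [|n [IH0 IH1]]; first by rewrite !cheb0 !cheb1 rmorph0 rmorph1.
by split=> //; rewrite !chebSS rmorphB rmorphM IH0 IH1.
Qed.

Lemma chebN (A : comPzRingType) (y : A) n :
  cheb (- y) n = (-1) ^+ n.+1 * cheb y n.
Proof.
suff [] : cheb (- y) n = (-1) ^+ n.+1 * cheb y n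
  /\ cheb (- y) n.+1 = (-1) ^+ n.+2 * cheb y n.+1 by [].
elim: n => [|n [IH0 IH1]]; first by rewrite !cheb0 !cheb1; split; ring.
by split=> //; rewrite !chebSS IH0 IH1 !exprS; ring.
Qed.

Lemma cheb2 (A : comPzRingType) n : cheb (2%:R : A) n = n%:R.
Proof.
suff [] : cheb (2%:R : A) n = n%:R /\ cheb (2%:R : A) n.+1 = n.+1%:R by [].
elim: n => [|n [IH0 IH1]]; first by [].
by split=> //; rewrite chebSS IH0 IH1 -[n.+2]addn2 -[n.+1]addn1 !natrD; ring.
Qed.

Lemma size_cheb (A : nzRingType) (p : {poly A}) n :
  (size p <= 2)%N -> (size (cheb p n) <= n)%N.
Proof.
move=> sp; suff [] : (size (cheb p n) <= n)%N /\ (size (cheb p n.+1) <= n.+1)%N by [].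
elim: n => [|n [IH0 IH1]]; first by rewrite cheb0 cheb1 size_poly0 size_poly1.
split=> //; rewrite chebSS (leq_trans (size_polyD _ _)) // size_polyN geq_max.
apply/andP; split; last exact: leq_trans IH0 (leqW (leqnSn n)).
apply: leq_trans (size_polyMleq _ _) _.
by rewrite -subn1 leq_subLR; apply: leq_add sp IH1.
Qed.

Lemma fps_coef_expr1X (R : comNzRingType) n k :
  fps_coef ((1 + fpsX R) ^+ n) k = 'C(n, k)%:R.
Proof.
elim: n k => [|n IHn] k; first by rewrite expr0 fps_coef1 bin0n.
rewrite exprS mulrDl mul1r fps_coefD fps_coefXM IHn.
by case: k => [|k]; rewrite ?bin0 ?addr0 // IHn binS natrD.
Qed.

Lemma fps_coefXnM (R : comNzRingType) (f : fps R) m n :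
  fps_coef (fpsX R ^+ m * f) (m + n) = fps_coef f n.
Proof. by elim: m => [|m IHm]; rewrite ?mul1r // exprS -mulrA addSn fps_coefXM. Qed.

Lemma fps_coefXnM_lt (R : comNzRingType) (f : fps R) m n : (n < m)%N ->
  fps_coef (fpsX R ^+ m * f) n = 0.
Proof.
by elim: m n => // m IHm [|n] nm; rewrite exprS -mulrA fps_coefXM // IHm.
Qed.

Lemma fps_coefCM (R : comNzRingType) (f : fps R) c n :
  fps_coef (fpsC c * f) n = c * fps_coef f n.
Proof.
rewrite fps_coefM big_ord_recl subn0 big1 ?addr0 // => i _.
by rewrite fps_coefC mul0r.
Qed.

(** * Linear functionals on polynomials given by their moments *)

Section Moments.
Variables (R : comNzRingType) (m : nat -> R).
Implicit Types p q : {poly R}.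

Definition moment p : R := \sum_(i < size p) p`_i * m i.

Lemma moment_widen p n : (size p <= n)%N -> moment p = \sum_(i < n) p`_i * m i.
Proof.
move=> pn; rewrite /moment (big_ord_widen n (fun i => p`_i * m i) pn) big_mkcond.
apply: eq_bigr => i _; case: ltnP => // /leq_sizeP/(_ _ (leqnn _)) ->.
by rewrite mul0r.
Qed.

Fact moment_is_scalar : scalar moment.
Proof.
move=> c p q; set n := maxn (size p) (size q).
have np : (size p <= n)%N by rewrite leq_maxl.
have nq : (size q <= n)%N by rewrite leq_maxr.
rewrite (@moment_widen _ n) ?(moment_widen np) ?(moment_widen nq); last first.
  rewrite (leq_trans (size_polyD _ _)) // geq_max nq andbT.
  exact: leq_trans (size_scale_leq _ _) np.
rewrite mulr_sumr -big_split; apply: eq_bigr => i _ /=.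
by rewrite coefD coefZ mulrDl mulrA.
Qed.
HB.instance Definition _ :=
  GRing.isLinear.Build R {poly R} R *%R moment moment_is_scalar.

Lemma momentCM c p : moment (c%:P * p) = c * moment p.
Proof. by rewrite mul_polyC linearZ. Qed.

Lemma momentXn k : moment 'X^k = m k.
Proof.
rewrite (@moment_widen _ k.+1) ?size_polyXn // big_ord_recr /= coefXn eqxx mul1r.
by rewrite big1 ?add0r // => i _; rewrite coefXn ltn_eqF // mul0r.
Qed.

Lemma momentXnM p k n : (size p <= n)%N ->
  moment ('X^k * p) = \sum_(i < n) p`_i * m (k + i).
Proof.
move=> pn; have {1}-> : p = \sum_(i < n) p`_i *: 'X^i.
  rewrite -poly_def; apply/polyP => i; rewrite coef_poly.
  by case: ltnP => // ni; rewrite (leq_sizeP _ _ pn).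
rewrite mulr_sumr linear_sum; apply: eq_bigr => i _.
by rewrite -scalerAr -exprD linearZ /= momentXn.
Qed.
End Moments.

Lemma fps_unit1DX (R : comUnitRingType) (f : fps R) :
  1 + fpsX R * f \is a GRing.unit.
Proof. by rewrite fps_unitE fps_coefD fps_coef1 fps_coefXM addr0 unitr1. Qed.

(** * The moments [a_k] and the values [L(V_n)] *)

Section Hankel.
Variables (R : comUnitRingType) (x : R).

(** A scalar [x] replaces the indeterminate, as ['X] is to stand for [Y]. *)
Definition binom_moment k : R :=
  \sum_(0 <= i < k.+1) 'C(2 * k + 2 - i, k - i)%:R * x ^+ i.

(* The shift by one makes [L(X p)] the functional with moments [a_k]. *)
Definition hmoment k : R := if k is k'.+1 then binom_moment k' else 0.

Local Notation L := (moment hmoment).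
Local Notation u := (fpsX R).

(** The product [(1 - u)(1 + u - x u)], expanded. *)
Definition denom : fps R := 1 - fpsC x * u + (fpsC x - 1) * u ^+ 2.
Definition momV_ser : fps R := u ^+ 2 / denom.
Definition momV n : R := fps_coef momV_ser n.

Lemma denom_unit : denom \is a GRing.unit.
Proof.
have -> : denom = 1 + u * ((fpsC x - 1) * u - fpsC x) by rewrite /denom; ring.
exact: fps_unit1DX.
Qed.

Lemma denomM : denom * momV_ser = u ^+ 2.
Proof. by rewrite mulrC divrK ?denom_unit. Qed.

Lemma momV_serE :
  momV_ser = u ^+ 2 + fpsC x * (u * momV_ser) - (fpsC x - 1) * (u ^+ 2 * momV_ser).
Proof. by rewrite -{1}denomM /denom; ring. Qed.

Lemma momV0 : momV 0%N = 0. Proof. by rewrite /momV fps_coefXnM_lt. Qed.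
Lemma momV1 : momV 1%N = 0. Proof. by rewrite /momV fps_coefXnM_lt. Qed.

Lemma momVSS n : momV n.+2 = (n == 0%N)%:R + x * momV n.+1 - (x - 1) * momV n.
Proof.
rewrite {1}/momV momV_serE fps_coefD fps_coefD fps_coefN fps_coefXn !eqSS.
rewrite -(rmorph1 (@fpsC R)) -rmorphB !fps_coefCM fps_coefXM.
by rewrite -[n.+2]add2n fps_coefXnM.
Qed.

(** Start of the induction in [moment_XnV]. The binomial sum is a coefficient of a truncated
    geometric series, and the truncation only affects higher orders. *)
Lemma hmomentE k :
  hmoment k = fps_coef ((1 + u) ^+ (2 * k) * (1 - u ^+ 2) * momV_ser) k.+1.
Proof.
case: k => [|k].
  rewrite muln0 expr0 mul1r mulrBl mul1r fps_coefD fps_coefN -/(momV 1%N) momV1.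
  by rewrite fps_coefXnM_lt // subr0.
set k1 := k.+1.
(* [S] is a geometric sum: it agrees with [(1 + u)^(2 k1 + 1) / (1 + u - x u)]
   below [u^k1]. *)
set S : fps R :=
  \sum_(i < k1) (fpsC x * u) ^+ i * (1 + u) ^+ (2 * k1 - i).
have ES : (1 + u - fpsC x * u) * S
    = (1 + u) ^+ k1.+1 * ((1 + u) ^+ k1 - (fpsC x * u) ^+ k1).
  rewrite subrXX [RHS]mulrCA; congr (_ * _); rewrite mulr_sumr.
  apply: eq_bigr => i _; rewrite mulrA -exprD mulrC; congr (_ ^+ _ * _).
  by have := ltn_ord i; rewrite /k1; lia.
have -> : (1 + u) ^+ (2 * k1) * (1 - u ^+ 2) * momV_ser = u ^+ 2 * S
    + u ^+ k1.+2 * ((1 - u) * (1 + u) ^+ k1.+1 * fpsC x ^+ k1 / denom).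
  apply: (mulrI denom_unit); rewrite [RHS]mulrDr [LHS]mulrCA denomM.
  have -> : denom * (u ^+ 2 * S) = (1 - u) * u ^+ 2 * ((1 + u - fpsC x * u) * S).
    by rewrite /denom; ring.
  rewrite ES [denom * (u ^+ k1.+2 * _)]mulrCA [denom * _]mulrC divrK ?denom_unit //.
  by rewrite mul2n -addnn exprD exprMn !exprS; ring.
rewrite fps_coefD [X in _ + X]fps_coefXnM_lt // addr0 -[k1.+1]add2n fps_coefXnM.
rewrite /= /binom_moment big_mkord.
have coef_sum (I : finType) (f : I -> fps R) n :
    fps_coef (\sum_i f i) n = \sum_i fps_coef (f i) n.
  by elim/big_rec2: _ => // i y1 y2 _ <-.
rewrite /S coef_sum; apply: eq_bigr => i _.
rewrite exprMn -rmorphXn -mulrA fps_coefCM mulrC; congr (_ * _).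
have ik : (i <= k)%N by rewrite -ltnS.
rewrite -[X in fps_coef _ X](subnKC ik) fps_coefXnM fps_coef_expr1X.
congr ('C(_ - i, _)%:R).
by rewrite /k1; lia.
Qed.

Local Notation V := (cheb ('X - 2%:R : {poly R})).

(** Induction on [j] by the Chebyshev recurrence, for all [k] at once since the factor [X] raises
    [k]. *)
Lemma moment_XnV k j :
  L ('X^k * V j) =
  fps_coef ((1 + u) ^+ (2 * k) * (1 - u ^+ (2 * j)) * momV_ser) (k + j).
Proof.
pose lam k j := fps_coef ((1 + u) ^+ (2 * k) * (1 - u ^+ (2 * j)) * momV_ser) (k + j).
suff /(_ k)[] : forall k, L ('X^k * V j) = lam k j /\ L ('X^k * V j.+1) = lam k j.+1.
  by [].
elim: j {k} => [|j IHj] k.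
  rewrite cheb0 cheb1 mulr0 linear0 mulr1 momentXn hmomentE /lam muln0.
  rewrite expr0 subrr mulr0 mul0r; split=> //.
  by rewrite addn1.
split; first by case: (IHj k).
rewrite chebSS; have -> : 'X^k * (('X - 2%:R) * V j.+1 - V j) =
    'X^(k.+1) * V j.+1 - 'X^k * V j.+1 - 'X^k * V j.+1 - 'X^k * V j.
  by rewrite exprS; ring.
rewrite !linearB /=; case: (IHj k) => -> ->; case: (IHj k.+1) => _ ->.
rewrite /lam; set n := (k + j.+2)%N.
have -> : (k.+1 + j.+1)%N = n by rewrite /n; lia.
(* Factors [u] and [u^2] bring all coefficients to the index [n]; the rest is
   [(1 + u)^2 - 2u = 1 + u^2]. *)
rewrite -(fps_coefXM _ (k + j.+1).+1) -(fps_coefXnM _ 2 (k + j)).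
have -> : ((k + j.+1).+1)%N = n by rewrite /n; lia.
have -> : (2 + (k + j))%N = n by rewrite /n; lia.
rewrite -!fps_coefN -!fps_coefD; congr (fps_coef _ _).
by rewrite !mul2n -!addnn !addnS !addSn !exprS; ring.
Qed.

Lemma momentV j : L (V j) = momV j.
Proof.
rewrite -[V j]mul1r -(expr0 'X) moment_XnV muln0 expr0 mul1r add0n.
rewrite mulrBl mul1r fps_coefD fps_coefN -/(momV j).
case: j => [|j]; first by rewrite muln0 expr0 mul1r subrr momV0.
by rewrite fps_coefXnM_lt ?subr0 //; lia.
Qed.

(** * The almost orthogonal polynomials [F_n] *)

Definition quasi_poly i : {poly R} := V i.+2 - x%:P * V i.+1 + (x - 1)%:P * V i.

Lemma quasi_polySS i :
  quasi_poly i.+2 = ('X - 2%:R) * quasi_poly i.+1 - quasi_poly i.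
Proof.
by rewrite /quasi_poly !(chebSS _ i.+2) !(chebSS _ i.+1) (chebSS _ i); ring.
Qed.

Lemma mulXV j : ('X - 2%:R) * V j.+1 = V j.+2 + V j.
Proof. by rewrite chebSS subrK. Qed.

(** The coefficients of [quasi_poly] are those of [denom], so [momVSS] gives [i = 0], and the
    recurrence in [i] does the rest. For [j <= i] truncated subtraction leaves [momV 0 = 0], so
    [F_i] is orthogonal to [V_1, ..., V_i]. *)
Lemma moment_quasiV i j :
  L (quasi_poly i * V j.+1) = (j == i)%:R + (2%:R - x) * momV (j - i).
Proof.
have phi0 k : L (quasi_poly 0 * V k.+1) = (k == 0%N)%:R + (2%:R - x) * momV k.
  have -> : quasi_poly 0 * V k.+1 = V k.+2 + V k - x%:P * V k.+1.
    by rewrite -mulXV /quasi_poly chebSS cheb1 cheb0; ring.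
  by rewrite linearB linearD /= momentCM !momentV momVSS; ring.
suff /(_ j)[] : forall j,
    L (quasi_poly i * V j.+1) = (j == i)%:R + (2%:R - x) * momV (j - i) /\
    L (quasi_poly i.+1 * V j.+1) = (j == i.+1)%:R + (2%:R - x) * momV (j - i.+1).
  by [].
elim: i {j} => [|i IHi] j.
  rewrite subn0; split=> //.
  (* [F_1] obeys the recurrence with the constant [2 - x] in place of [F_(-1)]. *)
  have -> : quasi_poly 1 * V j.+1 =
      quasi_poly 0 * V j.+2 + quasi_poly 0 * V j - (2%:R - x)%:P * V j.+1.
    rewrite -[quasi_poly 0 * V j.+2 + _]mulrDr -mulXV /quasi_poly !chebSS cheb1 cheb0.
    by rewrite !polyCB (rmorph_nat (@polyC R)) polyC1; ring.
  rewrite linearB linearD /= momentCM momentV phi0 /=.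
  case: j => [|j]; first by rewrite cheb0 mulr0 linear0 /= momV0; ring.
  by rewrite phi0 subSS subn0 eqSS; ring.
split; first by case: (IHi j).
have -> : quasi_poly i.+2 * V j.+1 =
    quasi_poly i.+1 * V j.+2 + quasi_poly i.+1 * V j - quasi_poly i * V j.+1.
  by rewrite quasi_polySS -[_ + quasi_poly i.+1 * V j]mulrDr -mulXV; ring.
rewrite linearB linearD /=; case: (IHi j.+1) => _ ->; case: (IHi j) => -> _.
case: j => [|j]; last first.
  by case: (IHi j) => _ ->; rewrite !eqSS !subSS; ring.
by rewrite mulr0 linear0 /= !subSS !sub0n eqSS momV0; ring.
Qed.

(** * The Chebyshev values [W_n] and the sums [K_n] *)

Local Notation W := (cheb x).

Definition kern_poly n : {poly R} := 1 - \sum_(i < n) (W i)%:P * quasi_poly i.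

Lemma kern_polyS n : kern_poly n.+1 = kern_poly n - (W n)%:P * quasi_poly n.
Proof. by rewrite /kern_poly big_ord_recr opprD addrA. Qed.

Lemma cheb_ser : (1 - fpsC x * u + u ^+ 2) * Fps W = u.
Proof.
apply/fpsP => n.
rewrite mulrDl mulrBl mul1r -mulrA fps_coefD fps_coefD fps_coefN fps_coefCM.
rewrite fps_coefXM.
case: n => [|[|n]]; first by rewrite fps_coefXnM_lt //= ?chebSS ?cheb1 ?cheb0; ring.
  by rewrite fps_coefXnM_lt //= ?chebSS ?cheb1 ?cheb0; ring.
by rewrite -[n.+2]add2n fps_coefXnM /= chebSS; ring.
Qed.

(** Adding [(2 - x) u^2] to [denom] gives [1 - x u + u^2], the denominator of the series of [W]. *)
Lemma momV_conv n : momV n.+1 = W n + (2%:R - x) * \sum_(i < n) W i * momV (n - i).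
Proof.
have -> : \sum_(i < n) W i * momV (n - i) = fps_coef (Fps W * momV_ser) n.
  rewrite fps_coefM big_ord_recr /= subnn -[X in _ + _ * X]/(momV 0%N) momV0.
  by rewrite mulr0 addr0.
rewrite -(fps_coefXM (Fps W * momV_ser) n.+1) -fps_coefCM.
rewrite -[W n]/(fps_coef (Fps W) n) -(fps_coefXM (Fps W) n.+1) -fps_coefD.
congr (fps_coef _ _); apply: (mulrI denom_unit); rewrite denomM.
have -> : denom * (u * Fps W + fpsC (2%:R - x) * (u * (Fps W * momV_ser)))
    = u * Fps W * (denom + fpsC (2%:R - x) * (denom * momV_ser)) by ring.
rewrite denomM expr2 -[X in X * _ = _]cheb_ser /denom rmorphB rmorph_nat.
ring.
Qed.

(** The diagonal value is [momV_conv]. Passing to [n + 1] subtracts [W_n F_n], which cancels it and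
    is orthogonal to the earlier [V_(j+1)]. *)
Lemma moment_kernV n j : (j <= n)%N ->
  L (kern_poly n * V j.+1) = (j == n)%:R * W n.
Proof.
have diag k : L (kern_poly k * V k.+1) = W k.
  rewrite mulrBl mul1r linearB /= momentV mulr_suml linear_sum /= momV_conv.
  apply/eqP; rewrite subr_eq mulr_sumr; apply/eqP; congr (_ + _).
  apply: eq_bigr => i _; rewrite -mulrA momentCM moment_quasiV gtn_eqF // add0r.
  by rewrite mulrCA.
elim: n => [|n IHn]; first by rewrite leqn0 => /eqP ->; rewrite diag eqxx mul1r.
rewrite leq_eqVlt => /predU1P[->|jn]; first by rewrite diag eqxx mul1r.
rewrite kern_polyS mulrBl linearB /= -mulrA momentCM moment_quasiV IHn //.
have /eqP -> : (j - n == 0)%N by rewrite subn_eq0.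
by rewrite momV0 (ltn_eqF jn) /=; ring.
Qed.

(** * Orthogonal polynomials, up to a factor [X] *)

Definition orth_poly n : {poly R} :=
  (kern_poly n).[0]%:P * quasi_poly n - (quasi_poly n).[0]%:P * kern_poly n.

Lemma horner_kernS n :
  (kern_poly n.+1).[0] = (kern_poly n).[0] - (quasi_poly n).[0] * W n.
Proof. by rewrite kern_polyS !hornerE mulrC. Qed.

Lemma moment_orthV n j : (j <= n)%N ->
  L (orth_poly n * V j.+1) = (j == n)%:R * (kern_poly n.+1).[0].
Proof.
move=> jn; rewrite mulrBl linearB /= -!mulrA !momentCM moment_quasiV moment_kernV //.
have /eqP -> : (j - n == 0)%N by rewrite subn_eq0.
by rewrite horner_kernS momV0; ring.
Qed.

(** In [X V_(j+1) = V_(j+2) + 2 V_(j+1) + V_j] only the top term can reach the critical index. The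
    case [j = 0] is the goal; general [j] serves the induction. *)
Lemma moment_Xn_orthV n i j : (i + j <= n)%N ->
  L ('X^i * (orth_poly n * V j.+1)) = (i + j == n)%N%:R * (kern_poly n.+1).[0].
Proof.
elim: i j => [|i IHi] j ijn; first by rewrite expr0 mul1r moment_orthV.
have -> : 'X^(i.+1) * (orth_poly n * V j.+1) = 'X^i * (orth_poly n * V j.+2)
    + 'X^i * (orth_poly n * V j.+1) + 'X^i * (orth_poly n * V j.+1)
    + 'X^i * (orth_poly n * V j).
  by rewrite exprS chebSS; ring.
rewrite addSn in ijn *; rewrite 3!linearD /= !IHi ?addnS //; last exact: ltnW.
rewrite [(i + j == n)%N]ltn_eqF //; case: j ijn => [|j] ijn.
  by rewrite cheb0 !mulr0 linear0 /=; ring.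
have ijn' : (i + j < n)%N by apply: leq_ltn_trans ijn; rewrite addnS.
by rewrite IHi ?(ltnW ijn') // [(i + j == n)%N]ltn_eqF //=; ring.
Qed.

(** * Degrees, extreme coefficients and values at zero *)

Lemma sizeV n : (size (V n) <= n)%N.
Proof. by apply: size_cheb; rewrite -polyC_natr size_XsubC. Qed.

Lemma size_polyCM (c : R) p : (size (c%:P * p)%R <= size p)%N.
Proof. by rewrite mul_polyC size_scale_leq. Qed.

Lemma size_quasi n : (size (quasi_poly n) <= n.+2)%N.
Proof.
rewrite /quasi_poly; apply: leq_trans (size_polyD _ _) _; rewrite geq_max.
apply/andP; split.
  apply: leq_trans (size_polyD _ _) _; rewrite geq_max sizeV size_polyN.
  by apply: leq_trans (size_polyCM _ _) _; apply: leqW; exact: sizeV.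
by apply: leq_trans (size_polyCM _ _) _; do 2 apply: leqW; exact: sizeV.
Qed.

Lemma size_kern n : (size (kern_poly n) <= n.+1)%N.
Proof.
elim: n => [|n IHn]; first by rewrite /kern_poly big_ord0 subr0 size_poly1.
rewrite kern_polyS; apply: leq_trans (size_polyD _ _) _.
rewrite geq_max leqW // size_polyN.
by apply: leq_trans (size_polyCM _ _) _; exact: size_quasi.
Qed.

Lemma size_orth n : (size (orth_poly n) <= n.+2)%N.
Proof.
rewrite /orth_poly; apply: leq_trans (size_polyD _ _) _; rewrite geq_max size_polyN.
apply/andP; split; apply: leq_trans (size_polyCM _ _) _; first exact: size_quasi.
exact: leqW (size_kern n).
Qed.

Lemma coefV_ge n i : (n <= i)%N -> (V n)`_i = 0.
Proof. by move=> ni; rewrite nth_default // (leq_trans (sizeV n)). Qed.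

Lemma coefV_lead n : (V n.+1)`_n = 1.
Proof.
elim: n => [|n IHn]; first by rewrite cheb1 coef1.
rewrite chebSS mulrBl coefB coefB coefXM IHn mulr_natl coefMn.
by rewrite !coefV_ge // mul0rn !subr0.
Qed.

Lemma coef_quasi_lead n : (quasi_poly n)`_n.+1 = 1.
Proof.
rewrite /quasi_poly coefD coefB !coefCM coefV_lead.
by rewrite !coefV_ge // !mulr0 subr0 addr0.
Qed.

Lemma coef_orth_lead n : (orth_poly n)`_n.+1 = (kern_poly n).[0].
Proof.
rewrite /orth_poly coefB !coefCM coef_quasi_lead mulr1.
by rewrite [(kern_poly n)`_ _]nth_default ?size_kern // mulr0 subr0.
Qed.

Lemma coef_orth0 n : (orth_poly n)`_0 = 0.
Proof. by rewrite -horner_coef0 /orth_poly !hornerE [X in X - _]mulrC subrr. Qed.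

(** At [X = 0] the polynomial [V_k] is [cheb] at [-2], that is [(-1)^(k+1) k]. *)
Lemma horner_quasi n :
  (quasi_poly n).[0] = (-1) ^+ n.+1 * ((2 * n + 1)%N%:R * x + 2%:R).
Proof.
have V0 k : (V k).[0] = (-1) ^+ k.+1 * k%:R.
  rewrite -[LHS]/(horner_eval 0 (V k)) rmorph_cheb rmorphB rmorph_nat /=.
  by rewrite /horner_eval hornerX sub0r chebN cheb2.
rewrite /quasi_poly hornerD hornerD hornerN !hornerM !hornerC !V0 !exprS.
by rewrite -[n.+2]addn2 -[n.+1]addn1 !(natrD _ n) (natrD _ (2 * n)%N) natrM; ring.
Qed.

End Hankel.

(** Cramer's rule for the last unknown: multiply by the adjugate, whose corner cofactor has sign
    [+1]. *)
Lemma det_mx_last (R : comNzRingType) n (A : 'M[R]_n.+1) (v : 'cV[R]_n.+1) (h : R) :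
  A *m v = h *: delta_mx ord_max ord0 ->
  \det A * v ord_max ord0 = h * \det (row' ord_max (col' ord_max A)).
Proof.
move=> /(congr1 (mulmx (\adj A))); rewrite mulmxA mul_adj_mx mul_scalar_mx.
move=> /matrixP/(_ ord_max ord0); rewrite mxE => ->.
rewrite -scalemxAr mxE -colE !mxE /cofactor -signr_odd addnn odd_double expr0 mul1r.
by [].
Qed.

(** * Hankel determinants and their generating function *)

Section HankelDet.
Variables (R : comUnitRingType) (x : R).
Local Notation Hdet n :=
  (\det (\matrix_(i < n.+1, j < n.+1) binom_moment x (i + j))).
Local Notation u := (fpsX R).

(** The coefficients of [orth_poly x n.+1] divided by [X] solve the Hankel system with right-hand
    side supported in the last row; their last entry is [K_(n+1)(0)]. *)
Lemma hankel_ratio n :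
  Hdet n.+1 * (kern_poly x n.+1).[0] = (kern_poly x n.+2).[0] * Hdet n.
Proof.
have bumpE (i : 'I_n.+1) : bump n.+1 i = i by rewrite /bump leqNgt ltn_ord.
pose v : 'cV[R]_n.+2 := \col_k (orth_poly x n.+1)`_k.+1.
have := @det_mx_last _ _ (\matrix_(i, j) binom_moment x (i + j)) v
  (kern_poly x n.+2).[0].
rewrite mxE /= coef_orth_lead => ->.
  congr (_ * \det _); apply/matrixP => i j; rewrite !mxE /=.
  by rewrite !bumpE.
apply/colP => i; rewrite !mxE andbT.
have := @moment_Xn_orthV _ x n.+1 i 0.
rewrite addn0 cheb1 mulr1 -ltnS ltn_ord => /(_ isT).
(* The constant term vanishes, and the index shift turns [hmoment] into [binom_moment]. *)
rewrite (momentXnM _ _ (size_orth x n.+1)) big_ord_recl coef_orth0 mul0r add0r => E.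
rewrite mulrC -[i == _]/(i == n.+1 :> nat) -E; apply: eq_bigr => k _.
by rewrite !mxE mulrC /bump /= addnS.
Qed.

(** The differences of [K_n(0)] contain [n W_n] up to sign; the factor [n] differentiates a series
    with denominator [1 + x u + u^2], whence the square. *)
Lemma kern_poly_gf :
  (1 + fpsC x * u + u ^+ 2) ^+ 2 * Fps (fun n => (kern_poly x n.+1).[0]) =
  1 - u + u ^+ 2 - u ^+ 3 - fpsC x * u - 3%:R * fpsC x * u ^+ 2.
Proof.
set h := Fps _; set c := 1 + _ + _.
(* [s] is [u] times the derivative of [v]: [cs] follows from differentiating [cv]. *)
pose v : fps R := Fps (cheb (- x)).
pose s : fps R := Fps (fun n => n%:R * cheb (- x) n).
have cv : c * v = u.
  by rewrite -[RHS](cheb_ser (- x)) rmorphN mulNr opprK.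
have cs : c * s = u - (fpsC x * u + 2%:R * u ^+ 2) * v.
  apply/fpsP => n; rewrite /c !mulrDl -!mulrA !mul1r.
  rewrite !(fps_coefD, fps_coefN, fps_coefCM, fps_coefXM).
  case: n => [|[|n]]; rewrite ?fps_coefXM ?(cheb0, cheb1) /= ?(cheb0, cheb1); try ring.
  rewrite chebSS -[n.+2]addn2 -[n.+1]addn1 !(natrD _ n); ring.
(* Multiplication by [1 - u] takes differences; [(-1)^(n+1) W_n] is [cheb (- x) n], and [2n + 1]
   becomes [s + s + v]. *)
have hE : (1 - u) * h = 1 - fpsC x * (s + s + v) - (v + v).
  apply/fpsP => n; rewrite mulrBl mul1r !(fps_coefD, fps_coefN) fps_coefCM.
  rewrite !fps_coefD fps_coefXM fps_coef1 /= chebN.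
  have step k : (kern_poly x k.+1).[0] = (kern_poly x k).[0]
      - (-1) ^+ k.+1 * ((2 * k + 1)%N%:R * x + 2%:R) * cheb x k.
    by rewrite horner_kernS horner_quasi.
  case: n => [|n].
    by rewrite step /kern_poly big_ord0 subr0 cheb0 !hornerE /=; ring.
  by rewrite step /= natrD natrM; ring.
have U1 : 1 - u \is a GRing.unit.
  by rewrite -[- u]mulrN1 fps_unit1DX.
apply: (mulrI U1); rewrite mulrCA hE.
have ccs : c * (c * s) = c * u - (fpsC x * u + 2%:R * u ^+ 2) * u.
  by rewrite cs mulrBr [c * (_ * v)]mulrCA cv.
have -> : c ^+ 2 * (1 - fpsC x * (s + s + v) - (v + v)) = c ^+ 2
    - fpsC x * (c * (c * s) + c * (c * s) + c * (c * v)) - (c * (c * v) + c * (c * v)).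
  by ring.
by rewrite ccs cv /c; ring.
Qed.
End HankelDet.

(* The value at [x = 0] is odd. *)
Lemma horner_kern_neq0 n : (kern_poly ('X : {poly int}) n).[0] != 0.
Proof.
have [z Ez] : exists z : int, (kern_poly ('X : {poly int}) n).[0].[0] = 1 + 2%:R * z.
  elim: n => [|n [z IHn]]; first
    by exists 0; rewrite /kern_poly big_ord0 subr0 !hornerE.
  exists (z - (-1) ^+ n.+1 * (cheb 'X n).[0]).
  rewrite horner_kernS horner_quasi hornerD hornerN IHn !hornerM hornerD hornerM hornerX.
  by rewrite mulr0 add0r horner_exp hornerN -polyC1 -polyC_natr !hornerC; ring.
apply: contra_eq_neq Ez => ->; rewrite horner0; lia.
Qed.

Lemma hankel_detE n : hankel_det n = (kern_poly 'X n.+1).[0].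
Proof.
have entryE k : hankel_entry k = binom_moment 'X k.
  by apply: eq_bigr => i _; rewrite scaler_nat mulr_natl.
have detE k : hankel_det k = \det (\matrix_(i < k.+1, j < k.+1) binom_moment 'X (i + j)).
  by congr (\det _); apply/matrixP => i j; rewrite !mxE entryE.
elim: n => [|n IHn].
  rewrite detE det_mx11 mxE /binom_moment big_nat1 horner_kernS cheb0 mulr0 subr0.
  by rewrite /kern_poly big_ord0 subr0 hornerC bin0 mulr1.
(* By [IHn] this factor equals [H_n], so it occurs on both sides of [hankel_ratio]. *)
apply: (mulIf (horner_kern_neq0 n.+1)).
by rewrite detE hankel_ratio -detE IHn.
Qed.

Theorem theorem3 :
  let t : fps {poly int} := fpsX {poly int} in
  let x : fps {poly int} := fpsC 'X in
  Fps hankel_det =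
    (1 - t + t ^+ 2 - t ^+ 3 - x * t - 3%:R * x * t ^+ 2)
      / (1 + x * t + t ^+ 2) ^+ 2.
Proof.
move=> t x; have -> : Fps hankel_det = Fps (fun n => (kern_poly 'X n.+1).[0]).
  by apply/fpsP => n; exact: hankel_detE.
rewrite -kern_poly_gf [X in X / _]mulrC mulrK // unitrX //.
have -> : 1 + x * t + t ^+ 2 = 1 + t * (x + t) by ring.
exact: fps_unit1DX.
Qed.
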